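(* Let $p\ge1$ and let $a_1,\dots,a_p,b_0,\dots,b_{p-1}$ be non-zero complex numbers, extended periodically ($a_{n+p}=a_n$ for $n\ge1$, $b_{n+p}=b_n$ for $n\ge0$). Assume the purely periodic continued fraction $$\alpha=b_0+\frac{a_1}{b_1}{+}\cdots{+}\frac{a_{p-1}}{b_{p-1}}{+}\frac{a_p}{b_0}{+}\frac{a_1}{b_1}{+}\cdots{+}\frac{a_{p-1}}{b_{p-1}}{+}\frac{a_p}{b_0}{+}\cdots$$ is convergent. Let $\lambda_1,\lambda_2$ with $|\lambda_1|\ge|\lambda_2|$ be the eigenvalues of $M=\begin{pmatrix}A_{p-1} & a_pA_{p-2}\\ B_{p-1} & a_pB_{p-2}\end{pmatrix}$, and let $x_1,x_2$ be the numbers with $\lambda_i=x_iB_{p-1}+a_pB_{p-2}$ ($i=1,2$) (these are uniquely defined, since convergence of $\alpha$ forces $B_{p-1}\neq0$). Then $\alpha=x_1$, and the reverse continued fraction $$\alpha'=b_0+\frac{a_p}{b_{p-1}}{+}\cdots{+}\frac{a_2}{b_1}{+}\frac{a_1}{b_0}{+}\frac{a_p}{b_{p-1}}{+}\cdots{+}\frac{a_2}{b_1}{+}\frac{a_1}{b_0}{+}\cdots$$ converges to $b_0-x_2$, except if $|\lambda_1|>|\lambda_2|$ and there exists $q\in\{0,\dots,p-2\}$ such that $A'_q-(b_0-x_1)B'_q=0$, in which case $\alpha'$ is divergent.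
   Context: For the continued fraction $\alpha$: $A_{-1}=1$, $A_0=b_0$, $B_{-1}=0$, $B_0=1$, $A_n=b_nA_{n-1}+a_nA_{n-2}$, $B_n=b_nB_{n-1}+a_nB_{n-2}$ ($n\ge1$). For the reverse fraction write $\alpha'=b'_0+\frac{a'_1}{b'_1}{+}\frac{a'_2}{b'_2}{+}\cdots$, i.e. $b'_0=b_0$ and, for $1\le j\le p$, $a'_j=a_{p+1-j}$, $b'_j=b_{p-j}$, extended periodically with period $p$; define $A'_{-1}=1$, $A'_0=b_0$, $B'_{-1}=0$, $B'_0=1$, $A'_n=b'_nA'_{n-1}+a'_nA'_{n-2}$, $B'_n=b'_nB'_{n-1}+a'_nB'_{n-2}$ ($n\ge1$). An infinite continued fraction is convergent if its denominators $B_n$ are non-zero for all large $n$ and the convergents $A_n/B_n$ tend to a finite limit (its value); otherwise it is divergent. *)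

(* Defs.v *)
From HB Require Import structures.
From mathcomp Require Import all_boot all_order all_algebra complex.
From mathcomp Require Import boolp classical_sets reals topology normedtype.
From mathcomp Require Import sequences.

Set Implicit Arguments.
Unset Strict Implicit.
Unset Printing Implicit Defensive.

Import Order.TTheory GRing.Theory Num.Theory.
Import numFieldNormedType.Exports.

Local Open Scope classical_set_scope.
Local Open Scope ring_scope.

(* The continued fraction b_0 + a_1/b_1 + a_2/b_2 + ... is given by two
   sequences a, b : nat -> K; the value a 0 is never used.

   The canonical numerators and denominators are indexed from -1 in the
   literature; here the index is shifted by one:
     cf_num a b n = A_{n-1},   cf_den a b n = B_{n-1}. *)

Fixpoint cf_num (K : pzRingType) (a b : nat -> K) (n : nat) : K :=
  match n with
  | 0 => 1
  | 1 => b 0%N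
  | (m.+1 as k).+1 => b k * cf_num a b k + a k * cf_num a b m
  end.

Fixpoint cf_den (K : pzRingType) (a b : nat -> K) (n : nat) : K :=
  match n with
  | 0 => 0
  | 1 => 1
  | (m.+1 as k).+1 => b k * cf_den a b k + a k * cf_den a b m
  end.

Definition cf_converges_to (K : numFieldType) (a b : nat -> K) (l : K) : Prop :=
  (\forall n \near \oo, cf_den a b n.+1 != 0) /\
  (fun n => cf_num a b n.+1 / cf_den a b n.+1) @ \oo --> l.

Definition cf_divergent (K : numFieldType) (a b : nat -> K) : Prop :=
  ~ exists l : K, cf_converges_to a b l.

(* Coefficients of the reverse continued fraction of period p: see rev_aE,
   rev_a_periodic, rev_b0, rev_bE and rev_b_periodic below. *)
Definition rev_a (K : Type) (p : nat) (a : nat -> K) (n : nat) : K :=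
  a (p - n.-1 %% p)%N.

Definition rev_b (K : Type) (p : nat) (b : nat -> K) (n : nat) : K :=
  b ((p - n %% p) %% p)%N.

Lemma rev_aE (K : Type) (p : nat) (a : nat -> K) (j : nat) :
  (1 <= j <= p)%N -> rev_a p a j = a (p.+1 - j)%N.
Proof. by case: j => // j jp; rewrite /rev_a /= modn_small // subSS. Qed.

Lemma rev_a_periodic (K : Type) (p : nat) (a : nat -> K) (n : nat) :
  (1 <= n)%N -> rev_a p a (n + p)%N = rev_a p a n.
Proof. by case: n => // n _; rewrite /rev_a addSn /= modnDr. Qed.

Lemma rev_b0 (K : Type) (p : nat) (b : nat -> K) : rev_b p b 0 = b 0%N.
Proof. by rewrite /rev_b mod0n subn0 modnn. Qed.

Lemma rev_bE (K : Type) (p : nat) (b : nat -> K) (j : nat) :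
  (1 <= j <= p)%N -> rev_b p b j = b (p - j)%N.
Proof.
move=> /andP[j0]; rewrite leq_eqVlt => /predU1P[->|jp].
  by rewrite /rev_b modnn subn0 modnn subnn.
by rewrite /rev_b (modn_small jp) modn_small // ltn_subrL j0 (ltn_trans j0 jp).
Qed.

Lemma rev_b_periodic (K : Type) (p : nat) (b : nat -> K) (n : nat) :
  rev_b p b (n + p)%N = rev_b p b n.
Proof. by rewrite /rev_b modnDr. Qed.

(* The matrix ((A_{p-1}, a_p A_{p-2}), (B_{p-1}, a_p B_{p-2})), for p >= 1. *)
Definition cf_mx (K : pzRingType) (p : nat) (a b : nat -> K) : 'M[K]_2 :=
  \matrix_(i < 2, j < 2)
    if i == 0 then (if j == 0 then cf_num a b p else a p * cf_num a b p.-1)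
    else (if j == 0 then cf_den a b p else a p * cf_den a b p.-1).

(* Main.v *)
(* Let e_i(n) = A_n - x_i B_n. Since (x_i, 1) is an eigenvector of M, advancing n
   by a period multiplies e_1 by lambda2 and e_2 by lambda1, so along each residue
   class mod p the ratio (A_n/B_n - x_1) / (A_n/B_n - x_2) is geometric with
   quotient lambda2 / lambda1. Its modulus is < 1, or the quotient is 1 (the
   parabolic case, where B_n grows by a linear factor), because a quotient of
   modulus one different from 1 would contradict the convergence of alpha.
   The period matrix of the reverse fraction is S M^T S^-1 with
   S = ((b_0, 1), (1, 0)), so its eigenvectors for lambda1 and lambda2 have slopes
   b_0 - x_2 and b_0 - x_1. When |lambda1| > |lambda2|, a residue class q
   misses the attracting slope b_0 - x_2 exactly when it starts on the repelling
   one, b_0 - x_1; the class of index -1 never does. *)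
Require Import Defs.
From mathcomp Require Import all_boot all_order all_algebra complex.
From mathcomp Require Import boolp classical_sets reals topology normedtype.
From mathcomp Require Import sequences.
From mathcomp Require Import ring zify.

Import Order.TTheory GRing.Theory Num.Theory.
Import numFieldNormedType.Exports.
Local Open Scope ring_scope.
Local Open Scope complex_scope.
Local Open Scope classical_set_scope.

(** * Limits along residue classes modulo the period *)

(** The residues are finitely many, so one threshold [N] on the quotient serves them all, and
    [n %/ p] reaches it once [n] reaches [N * p]. *)
Lemma near_residues (p : nat) (P : nat -> Prop) : (0 < p)%N ->
  (forall q, (q < p)%N -> \forall k \near \oo, P (q + k * p)%N) ->
  \forall n \near \oo, P n.
Proof.
move=> p0 H.
have [N _ HN] : \forall k \near \oo, forall i : 'I_p, P (i + k * p)%N.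
  by apply: filter_forall => i; apply: H.
exists (N * p)%N => // n /= Nn.
have := HN (n %/ p)%N; rewrite /= leq_divRL // => /(_ Nn (Ordinal (ltn_pmod n p0))).
by rewrite /= addnC -divn_eq.
Qed.

Lemma near_subseq (p q : nat) (P : nat -> Prop) : (0 < p)%N ->
  (\forall n \near \oo, P n) -> \forall k \near \oo, P (q + k * p)%N.
Proof.
move=> p0 [N _ HN]; exists N => // k /= Nk; apply: HN => /=.
by rewrite (leq_trans Nk) // (leq_trans (leq_pmulr k p0)) // leq_addl.
Qed.

(** The index stays shifted, which keeps the class of index -1 with its simple start (1, 0); free
    [N] and [D] allow restriction to a residue class. *)
Definition ratio_cvg {K : numFieldType} (N D : nat -> K) (l : K) : Prop :=
  (\forall n \near \oo, D n != 0) /\ (fun n => N n / D n) @ \oo --> l.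

Lemma cf_converges_toE (K : numFieldType) (a b : nat -> K) (l : K) :
  cf_converges_to a b l <-> ratio_cvg (cf_num a b) (cf_den a b) l.
Proof.
split=> -[nz cv]; split.
- exact: near_inftyS.
- by rewrite -cvg_shiftS.
- case: nz => N _ HN; exists N => // n Nn.
  by apply: (HN n.+1); apply: leqW.
- by rewrite (cvg_shiftS (fun n => cf_num a b n / cf_den a b n)).
Qed.

Lemma ratio_cvg_unique (K : numFieldType) (N D : nat -> K) (l m : K) :
  ratio_cvg N D l -> ratio_cvg N D m -> l = m.
Proof. by move=> [_ cl] [_ cm]; apply: norm_cvg_unique cl cm. Qed.

Lemma ratio_cvg_residues (K : numFieldType) (p : nat) (N D : nat -> K) (l : K) :
  (0 < p)%N ->
  (forall q, (q < p)%N ->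
    ratio_cvg (fun k => N (q + k * p)%N) (fun k => D (q + k * p)%N) l) ->
  ratio_cvg N D l.
Proof.
move=> p0 H; split; first by apply: (near_residues _ _ p0) => q /H[].
by move=> A lA; apply: (near_residues _ _ p0) => q /H[_]; apply.
Qed.

Lemma ratio_cvg_subseq (K : numFieldType) (p q : nat) (N D : nat -> K) (l : K) :
  (0 < p)%N -> ratio_cvg N D l ->
  ratio_cvg (fun k => N (q + k * p)%N) (fun k => D (q + k * p)%N) l.
Proof.
move=> p0 [nz cv]; split; first exact: (near_subseq p q _ p0 nz).
by move=> A lA; exact: (near_subseq p q (fun n => A (N n / D n)) p0 (cv _ lA)).
Qed.

(** * Convergence of a quotient read off from linear forms *)

Lemma ratio_cvg_proportional (K : numFieldType) (N D : nat -> K) (y : K) :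
  (\forall n \near \oo, D n != 0) -> (forall n, N n - y * D n = 0) ->
  ratio_cvg N D y.
Proof.
move=> nz ND; split=> //.
have cy : (fun _ : nat => y) @ \oo --> y by apply: cvg_cst.
apply: cvg_trans cy; apply: near_eq_cvg.
apply: filterS nz => n nz; rewrite /= -(subr0 (N n)) -(ND n).
by field.
Qed.

(** The quotient [u] is the Moebius coordinate of [N / D] with zero at [y] and pole at [z]. As
    [1 - u = (y - z) D / (N - z D)], the limit 0 of [u] keeps [D] away from 0 eventually, and
    [N / D = y + (y - z) u / (1 - u)]. *)
Lemma ratio_cvg_dominant (K : numFieldType) (N D : nat -> K) (y z : K) :
  y != z -> (forall n, N n - z * D n != 0) ->
  (fun n => (N n - y * D n) / (N n - z * D n)) @ \oo --> (0 : K) ->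
  ratio_cvg N D y.
Proof.
move=> yz nz u0; pose u n := (N n - y * D n) / (N n - z * D n).
have yz' : y - z != 0 by rewrite subr_eq0.
have DE n : 1 - u n = (y - z) * D n / (N n - z * D n) by rewrite /u; field.
have u1 : (fun n => 1 - u n) @ \oo --> (1 : K).
  by rewrite -[X in _ --> X]subr0; apply: cvgB u0; apply: cvg_cst.
have unz : \forall n \near \oo, 1 - u n != 0 by apply: cvgr_neq0 u1 (oner_neq0 K).
have Dnz : \forall n \near \oo, D n != 0.
  apply: filterS unz => n; rewrite DE.
  by apply: contraNneq => ->; rewrite mulr0 mul0r.
split=> //.
have -> : y = y + (y - z) * (0 * 1^-1) by rewrite mul0r mulr0 addr0.
have cv : (fun n => y + (y - z) * (u n * (1 - u n)^-1)) @ \oo -->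
   y + (y - z) * (0 * 1^-1).
  apply: cvgD; first exact: cvg_cst.
  apply: cvgM; first exact: cvg_cst.
  by apply: cvgM => //; apply: cvgV => //; apply: oner_neq0.
apply: cvg_trans cv; apply: near_eq_cvg.
by apply: filterS Dnz => n Dn /=; rewrite DE /u; field; rewrite nz Dn.
Qed.

(** * Complex null sequences *)

(** A positive element of [R[i]] is real, so the estimate descends to [R]. *)
Lemma cvg0_complex (R : realType) (u : nat -> R) (v : nat -> R[i]) :
  (forall n, `|v n| <= (u n)%:C) -> u @ \oo --> (0 : R) ->
  v @ \oo --> (0 : (R[i] : numFieldType)).
Proof.
move=> vu /cvgr0Pnorm_lt u0.
suff : forall e : R[i], 0 < e -> \forall n \near \oo, `|v n| < e.
  by move/(@cvgr0Pnorm_lt _ (R[i] : numFieldType)).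
move=> e e0.
have eE : e = (complex.Re e)%:C.
  by apply/eqP; rewrite eq_complex /= eqxx; move: e0; rewrite ltcE => /andP[].
have /u0 : 0 < complex.Re e by rewrite -ltcR -eE.
apply: filterS => n un; rewrite eE (le_lt_trans (vu n)) // ltcR.
exact: le_lt_trans (ler_norm _) un.
Qed.

Lemma cvg_exprC (R : realType) (z : R[i]) :
  `|z| < 1 -> (fun n => z ^+ n) @ \oo --> (0 : (R[i] : numFieldType)).
Proof.
move=> z1; have [r rE] : exists r : R, `|z| = r%:C by eexists; apply: normc_def.
have r0 : 0 <= r by rewrite -lecR -rE normr_ge0.
apply: (@cvg0_complex _ (fun n => r ^+ n)).
  by move=> n; rewrite normrX rE rmorphXn.
by apply: cvg_expr; rewrite ger0_norm // -ltcR -rE.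
Qed.

Lemma cvg_harmonicC (R : realType) :
  (fun n => n.+1%:R^-1) @ \oo --> (0 : (R[i] : numFieldType)).
Proof.
apply: (@cvg0_complex R harmonic); last exact: cvg_harmonic.
by move=> n; rewrite normfV normr_nat fmorphV /= rmorph_nat.
Qed.

(** * Eigenforms: geometric, parabolic and equimodular cases *)

Lemma geometric_subseq (K : comPzRingType) (p : nat) (c : K) (X : nat -> K) :
  (forall n, X (n + p)%N = c * X n) ->
  forall q k, X (q + k * p)%N = c ^+ k * X q.
Proof.
move=> H q; elim=> [|k IH]; first by rewrite mul0n addn0 mul1r.
by rewrite mulSnr addnA H IH exprS mulrA.
Qed.

Lemma ratio_cvg_geometric (R : realType) (p q : nat) (N D : nat -> R[i])
    (y z c d : R[i]) :
  (forall n, N (n + p)%N - y * D (n + p)%N = c * (N n - y * D n)) ->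
  (forall n, N (n + p)%N - z * D (n + p)%N = d * (N n - z * D n)) ->
  `|c| < `|d| -> y != z -> N q - z * D q != 0 ->
  ratio_cvg (fun k => N (q + k * p)%N : (R[i] : numFieldType))
    (fun k => D (q + k * p)%N) y.
Proof.
move=> Hy Hz cd yz q0.
have d0 : d != 0 by rewrite -normr_gt0 (le_lt_trans (normr_ge0 c)).
have Ey := geometric_subseq _ _ _ (fun n => N n - y * D n) Hy q.
have Ez := geometric_subseq _ _ _ (fun n => N n - z * D n) Hz q.
apply: (@ratio_cvg_dominant (R[i] : numFieldType) _ _ y z) => //.
  by move=> k; rewrite /= Ez mulf_neq0 // expf_neq0.
have cd1 : `|c / d| < 1 by rewrite normf_div ltr_pdivrMr ?normr_gt0 // mul1r.
have cv : (fun k => (c / d) ^+ k * ((N q - y * D q) / (N q - z * D q))) @ \oo -->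
    (0 : (R[i] : numFieldType)).
  rewrite -[X in _ --> X](mul0r ((N q - y * D q) / (N q - z * D q))).
  apply: (@cvgM (R[i] : numFieldType)); first exact: cvg_exprC.
  exact: cvg_cst.
apply: cvg_trans cv; apply: near_eq_cvg; apply: nearW => k /=.
by rewrite Ey Ez expr_div_n; field; rewrite q0 expf_neq0.
Qed.

(* With e = N q - y D q, the denominator after k periods is
   c^k (D q + k B e / c), while N - y D is only c^k e. *)
Lemma ratio_cvg_parabolic (R : realType) (p q : nat) (N D : nat -> R[i])
    (y c B : R[i]) :
  (forall n, N (n + p)%N - y * D (n + p)%N = c * (N n - y * D n)) ->
  (forall n, D (n + p)%N = c * D n + B * (N n - y * D n)) ->
  c != 0 -> B != 0 -> (N q != 0) || (D q != 0) ->
  ratio_cvg (fun k => N (q + k * p)%N : (R[i] : numFieldType))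
    (fun k => D (q + k * p)%N) y.
Proof.
move=> He HD c0 B0 q0.
have Ee := geometric_subseq _ _ _ (fun n => N n - y * D n) He q.
set e := N q - y * D q.
have ED k : D (q + k * p)%N = c ^+ k * (D q + k%:R * (B * e / c)).
  elim: k => [|k IH]; first by rewrite mul0n addn0 mul1r mul0r addr0.
  rewrite mulSnr addnA HD [N _ - _]Ee IH exprS -natr1 -/e.
  by field.
(* A class starting on the slope [y] stays there; then [D q] is nonzero, since otherwise [N q] would
   vanish too. *)
have [e0|e0] := eqVneq e 0.
  apply: (@ratio_cvg_proportional (R[i] : numFieldType)); last first.
    by move=> k; rewrite [LHS]Ee -/e e0 mulr0.
  apply: nearW => k; rewrite ED e0 mulr0 mul0r mulr0 addr0 mulf_neq0 ?expf_neq0 //.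
  case/orP: q0 => //; apply: contraNneq => Dq.
  by have := e0; rewrite /e Dq mulr0 subr0 => ->.
(* Dividing the denominator by its growth [c ^+ k.+1 * k.+1%:R] leaves [t], with nonzero limit [w];
   the shift to [k.+1] avoids division by zero. *)
pose s k := (k.+1%:R)^-1 : R[i]; pose w := B * e / c.
have w0 : w != 0 by rewrite !mulf_neq0 ?invr_eq0.
have s0 k : k.+1%:R != 0 :> R[i] by rewrite pnatr_eq0.
pose t k := s k * D q + w.
have tw : t @ \oo --> (w : (R[i] : numFieldType)).
  rewrite -[X in _ --> X]add0r -(mul0r (D q)).
  apply: (@cvgD (R[i] : numFieldType) (R[i] : numFieldType)); last exact: cvg_cst.
  apply: (@cvgM (R[i] : numFieldType)); first exact: cvg_harmonicC.
  exact: cvg_cst.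
have DE k : D (q + k.+1 * p)%N = c ^+ k.+1 * k.+1%:R * t k.
  by rewrite ED /t /s -/w; field; rewrite nat1r.
have tnz : \forall k \near \oo, t k != 0.
  exact: (@cvgr_neq0 _ (R[i] : numFieldType)) tw w0.
split.
  apply: near_inftyS; apply: filterS tnz => k tk.
  by rewrite DE !mulf_neq0 ?expf_neq0.
rewrite -(@cvg_shiftS (R[i] : numFieldType)).
have cv : (fun k => y + e * (s k * (t k)^-1)) @ \oo -->
    (y + e * (0 * w^-1) : (R[i] : numFieldType)).
  apply: (@cvgD (R[i] : numFieldType) (R[i] : numFieldType)); first exact: cvg_cst.
  apply: (@cvgM (R[i] : numFieldType)); first exact: cvg_cst.
  apply: (@cvgM (R[i] : numFieldType)); first exact: cvg_harmonicC.
  exact: (@cvgV (R[i] : numFieldType)).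
rewrite mul0r mulr0 addr0 in cv.
apply: cvg_trans cv; apply: near_eq_cvg; apply: filterS tnz => k tk /=.
have -> : N (q + k.+1 * p)%N = c ^+ k.+1 * e + y * D (q + k.+1 * p)%N.
  by rewrite -[c ^+ k.+1 * e]Ee subrK.
rewrite DE /s; field; rewrite nat1r expf_neq0 //.
by rewrite s0 tk.
Qed.

(* The ratio of the two eigenforms is a geometric sequence with quotient c / d
   of modulus one; if it converges, the quotient is 1. *)
Lemma ratio_cvg_equimodular (K : numFieldType) (p : nat) (N D : nat -> K)
    (y z c d l : K) : (0 < p)%N ->
  (forall n, N (n + p)%N - y * D (n + p)%N = c * (N n - y * D n)) ->
  (forall n, N (n + p)%N - z * D (n + p)%N = d * (N n - z * D n)) ->
  `|c| = `|d| -> y != z -> N 0%N = 1 -> D 0%N = 0 -> d != 0 ->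
  ratio_cvg (N : nat -> K) D l -> c = d.
Proof.
move=> p0 Hy Hz cd yz N0 D0 d0 /(ratio_cvg_subseq _ _ 0 _ _ _ p0) H.
pose n k := N (k * p)%N; pose m k := D (k * p)%N.
have {H} [nz cv] : ratio_cvg (n : nat -> K) m l := H.
have Ey k : n k - y * m k = c ^+ k.
  have := geometric_subseq _ _ _ (fun n => N n - y * D n) Hy 0 k.
  by rewrite add0n N0 D0 mulr0 subr0 mulr1.
have Ez k : n k - z * m k = d ^+ k.
  have := geometric_subseq _ _ _ (fun n => N n - z * D n) Hz 0 k.
  by rewrite add0n N0 D0 mulr0 subr0 mulr1.
have cvB x : (fun k => (n k - x * m k) / m k) @ \oo --> (l - x : K).
  have cv' : (fun k => n k / m k - x) @ \oo --> (l - x : K).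
    by apply: cvgB => //; exact: cvg_cst.
  apply: cvg_trans cv'; apply: near_eq_cvg; apply: filterS nz => k mk /=.
  by field.
(* Both forms have the same modulus at every multiple of [p], so [l] is equidistant from [y] and
   [z], hence distinct from both. *)
have lyz : `|l - y| = `|l - z|.
  have /cvg_norm cy := cvB y.
  have /cvg_norm cz := cvB z.
  apply: norm_cvg_unique cy _; apply: cvg_trans cz; apply: near_eq_cvg.
  by apply: nearW => k /=; rewrite Ey Ez !normf_div !normrX cd.
have lz : l - z != 0.
  apply: contra yz => /eqP lz; move: lyz; rewrite lz normr0 => /normr0_eq0 ly.
  by rewrite -(subr_eq0 y z) -[y](subKr l) ly subr0 lz.
have ly : l - y != 0 by rewrite -normr_gt0 lyz normr_gt0.
pose r k := (c / d) ^+ k.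
have cr : r @ \oo --> ((l - y) / (l - z) : K).
  have cv' : (fun k => ((n k - y * m k) / m k) * ((n k - z * m k) / m k)^-1)
      @ \oo --> ((l - y) / (l - z) : K).
    apply: cvgM; first exact: cvB.
    by apply: cvgV => //; exact: cvB.
  apply: cvg_trans cv'; apply: near_eq_cvg; apply: filterS nz => k mk /=.
  rewrite Ey Ez /r expr_div_n; field; rewrite expf_neq0 //.
have cr1 : (fun k => (c / d) * r k) @ \oo -->
    ((c / d) * ((l - y) / (l - z)) : K).
  by apply: cvgM => //; exact: cvg_cst.
(* Multiplying [r] by [c / d] only shifts it, so its nonzero limit is fixed by [c / d]. *)
have cr2 : (fun k => (c / d) * r k) @ \oo --> ((l - y) / (l - z) : K).
  have := cr; rewrite -(cvg_shiftS r).
  by under eq_fun do rewrite /r exprS.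
have rr : (c / d) * ((l - y) / (l - z)) = (l - y) / (l - z).
  by apply: norm_cvg_unique cr1 cr2.
have := mulIf (mulf_neq0 ly (invr_neq0 lz)) (etrans rr (esym (mul1r _))).
by move/divr1_eq.
Qed.

(** * The linear recurrence and its period *)

Lemma cf_num_rec (K : pzRingType) (a b : nat -> K) (n : nat) :
  cf_num a b n.+2 = b n.+1 * cf_num a b n.+1 + a n.+1 * cf_num a b n.
Proof. by []. Qed.

Lemma cf_den_rec (K : pzRingType) (a b : nat -> K) (n : nat) :
  cf_den a b n.+2 = b n.+1 * cf_den a b n.+1 + a n.+1 * cf_den a b n.
Proof. by []. Qed.

(** Each step multiplies this determinant by [- a n.+1]. It yields both the invertibility of the
    period matrix and a nonzero start in every residue class. *)
Lemma cf_cross_neq0 (K : fieldType) (a b : nat -> K) :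
  (forall n, a n.+1 != 0) -> forall n,
  cf_num a b n.+1 * cf_den a b n - cf_num a b n * cf_den a b n.+1 != 0.
Proof.
move=> a0; elim=> [|n IH]; first by rewrite /= mulr0 mul1r sub0r oppr_eq0 oner_neq0.
rewrite cf_num_rec cf_den_rec.
set x := (X in X != 0); have -> : x = - a n.+1 *
   (cf_num a b n.+1 * cf_den a b n - cf_num a b n * cf_den a b n.+1).
  by rewrite /x; ring.
by rewrite mulf_neq0 ?oppr_eq0.
Qed.

(** Two initial values determine a solution; the basis starts from [(1, b 0)] and [(0, 1)], whence
    the corrected second coefficient. *)
Lemma cf_solution (K : comPzRingType) (a b X : nat -> K) :
  (forall n, X n.+2 = b n.+1 * X n.+1 + a n.+1 * X n) ->
  forall n, X n = cf_num a b n * X 0%N + cf_den a b n * (X 1%N - b 0%N * X 0%N).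
Proof.
move=> HX; elim/ltn_ind=> -[|[|n]] IH.
- by rewrite /=; ring.
- by rewrite /=; ring.
- by rewrite HX cf_num_rec cf_den_rec (IH n.+1) // (IH n) //; ring.
Qed.

(** By periodicity the shifted sequence solves the same recurrence, and [b p = b 0] reduces its
    second coefficient to [a p * cf_num a b p.-1]. *)
Lemma cf_num_period (K : comPzRingType) (p : nat) (a b : nat -> K) : (0 < p)%N ->
  (forall n, a (n.+1 + p)%N = a n.+1) -> (forall n, b (n + p)%N = b n) ->
  forall n, cf_num a b (n + p)%N =
    cf_num a b p * cf_num a b n + a p * cf_num a b p.-1 * cf_den a b n.
Proof.
case: p => // p _ Ha Hb n; pose X n := cf_num a b (n + p.+1)%N.
rewrite [LHS](cf_solution _ a b X) /X; last first.
  by move=> k; rewrite !addSn cf_num_rec -!addSn Hb Ha.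
by rewrite add1n add0n cf_num_rec -(Hb 0%N) add0n; ring.
Qed.

Lemma cf_den_period (K : comPzRingType) (p : nat) (a b : nat -> K) : (0 < p)%N ->
  (forall n, a (n.+1 + p)%N = a n.+1) -> (forall n, b (n + p)%N = b n) ->
  forall n, cf_den a b (n + p)%N =
    cf_den a b p * cf_num a b n + a p * cf_den a b p.-1 * cf_den a b n.
Proof.
case: p => // p _ Ha Hb n; pose X n := cf_den a b (n + p.+1)%N.
rewrite [LHS](cf_solution _ a b X) /X; last first.
  by move=> k; rewrite !addSn cf_den_rec -!addSn Hb Ha.
by rewrite add1n add0n cf_den_rec -(Hb 0%N) add0n; ring.
Qed.

(** * Eigenvalues of a matrix of order two *)

Lemma eigenvalue_mx2 (F : fieldType) (M : 'M[F]_2) (l : F) :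
  eigenvalue M l <-> (M 0 0 - l) * (M 1 1 - l) - M 0 1 * M 1 0 = 0.
Proof.
have -> : eigenvalue M l = (\det (M - l%:M) == 0).
  rewrite /eigenvalue /eigenspace kermx_eq0 row_free_unit unitmxE unitfE negbK //.
rewrite (expand_det_row _ ord0) !big_ord_recl big_ord0 /cofactor !det_mx11 !mxE /=.
have -> : lift ord0 ord0 = 1 :> 'I_2 by apply/val_inj.
have -> : lift 1 ord0 = 0 :> 'I_2 by apply/val_inj.
rewrite !mulr0n !mulr1n !subr0 addr0 expr0 expr1 mul1r mulN1r mulrN.
by split=> /eqP.
Qed.

(* The conjugate root t - x of x is again a root. *)
Lemma quadratic_roots (F : idomainType) (t d x y : F) :
  (forall l, l ^+ 2 - t * l + d = 0 <-> l = x \/ l = y) ->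
  x + y = t /\ x * y = d.
Proof.
move=> H; have rx : x ^+ 2 - t * x + d = 0 by apply/H; left.
have rc : (t - x) ^+ 2 - t * (t - x) + d = 0 by rewrite -rx; ring.
have ry : y ^+ 2 - t * y + d = 0 by apply/H; right.
have tE : x + y = t.
  case/H: rc => [tx|<-]; last by ring.
  have tE : t = x + x by rewrite -[X in X + _]tx subrK.
  (* For a double root, [t = x + x] makes the difference of the values at [y] and [x] a square. *)
  suff : (y - x) ^+ 2 = 0 by move/eqP; rewrite expf_eq0 subr_eq0 => /eqP ->.
  transitivity ((y ^+ 2 - t * y + d) - (x ^+ 2 - t * x + d)).
    by rewrite tE; ring.
  by rewrite rx ry subrr.
by split=> //; apply/esym/eqP; rewrite -subr_eq0 -rx -tE; apply/eqP; ring.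
Qed.

(** * The reverse fraction and the eigenforms of a period *)

(* Entrywise form of the reversal of the product of the step matrices under
   transposition, moving one factor at a time. *)
Lemma cf_rev_bilinear (K : comPzRingType) (p : nat) (a b X Y : nat -> K) :
  (forall n, X n.+2 = rev_b p b n.+1 * X n.+1 + rev_a p a n.+1 * X n) ->
  (forall n, Y n.+2 = b n.+1 * Y n.+1 + a n.+1 * Y n) ->
  forall k, (k < p)%N ->
  X k.+1 * Y (p - k)%N + a (p - k)%N * X k * Y (p - k).-1
  = X 1%N * Y p + a p * X 0%N * Y p.-1.
Proof.
move=> HX HY; elim=> [|k IH] kp; first by rewrite subn0.
rewrite -IH ?(ltnW kp) // HX rev_bE ?rev_aE ?(ltnW kp) //.
have [j pE] : exists j, p = (j + k.+2)%N by exists (p - k.+2)%N; rewrite subnK.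
have -> : (p - k = j.+2)%N by rewrite pE; lia.
have -> : (p - k.+1 = j.+1)%N by rewrite pE; lia.
have -> : (p.+1 - k.+1 = j.+2)%N by rewrite pE; lia.
by rewrite HY /=; ring.
Qed.

(** The bilinear invariant at its last index, taken for all four pairs of numerators and
    denominators, gives equations for the entries of the reverse period matrix. *)
Lemma cf_rev_period (K : comPzRingType) (p : nat) (a b : nat -> K) : (0 < p)%N ->
  let a' := rev_a p a in let b' := rev_b p b in
  [/\ cf_den a' b' p = cf_den a b p,
      cf_num a' b' p = b 0%N * cf_den a b p + a p * cf_den a b p.-1,
      a' p * cf_den a' b' p.-1 = cf_num a b p - b 0%N * cf_den a b p
    & a' p * cf_num a' b' p.-1 = b 0%N * cf_num a b p + a p * cf_num a b p.-1
        - b 0%N * (b 0%N * cf_den a b p + a p * cf_den a b p.-1)].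
Proof.
case: p => // p _ a' b'; have pp : (p < p.+1)%N by [].
have aE : a' p.+1 = a 1%N by rewrite /a' rev_aE ?ltnS ?leqnn // subSnn.
have b0 : b' 0%N = b 0%N by rewrite /b' rev_b0.
have Hd := cf_den_rec _ a b; have Hn := cf_num_rec _ a b.
have Hd' := cf_den_rec _ a' b'; have Hn' := cf_num_rec _ a' b'.
have := cf_rev_bilinear _ p.+1 a b _ _ Hd' Hd p pp.
have := cf_rev_bilinear _ p.+1 a b _ _ Hd' Hn p pp.
have := cf_rev_bilinear _ p.+1 a b _ _ Hn' Hd p pp.
have := cf_rev_bilinear _ p.+1 a b _ _ Hn' Hn p pp.
rewrite subSnn aE [_.+1.-1]/=.
rewrite [cf_num _ _ 0]/= [cf_num _ _ 1]/= [cf_den _ _ 0]/= [cf_den _ _ 1]/=.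
rewrite [cf_num _ _ 0]/= [cf_num _ _ 1]/= [cf_den _ _ 0]/= [cf_den _ _ 1]/= b0.
rewrite !mulr0 !mul0r !mulr1 !mul1r !addr0 => nn nd dn dd.
split=> //.
- by rewrite -dn dd; ring.
- by rewrite -nn -nd; ring.
Qed.

(* (1, -y) is the left eigenvector for d when (y, 1) is the right one for c. *)
Lemma eigenform_period (K : idomainType) (p : nat) (N D : nat -> K)
    (A E B F c d y : K) :
  (forall n, N (n + p)%N = A * N n + E * D n) ->
  (forall n, D (n + p)%N = B * N n + F * D n) ->
  B != 0 -> c = y * B + F -> c + d = A + F -> c * d = A * F - E * B ->
  forall n, N (n + p)%N - y * D (n + p)%N = d * (N n - y * D n).
Proof.
move=> HN HD B0 cE tr dt n; rewrite HN HD.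
have -> : A = d + y * B by rewrite -[A](addrK F) -tr cE; ring.
have -> : E = y * F - d * y; last by ring.
apply: (mulIf B0); have -> : E * B = A * F - c * d by rewrite dt; ring.
by rewrite -[A](addrK F) -tr cE; ring.
Qed.

Theorem theorem3 (R : realType) (p : nat) (a b : nat -> R[i])
    (alpha lambda1 lambda2 : R[i])
    (p_ge1 : (1 <= p)%N)
    (a_neq0 : forall n, (1 <= n <= p)%N -> a n != 0)
    (b_neq0 : forall n, (n < p)%N -> b n != 0)
    (a_periodic : forall n, (1 <= n)%N -> a (n + p)%N = a n)
    (b_periodic : forall n, b (n + p)%N = b n)
    (alpha_cvg : cf_converges_to a b alpha)
    (eigenvalues : forall l : R[i],
       eigenvalue (cf_mx p a b) l <-> (l = lambda1 \/ l = lambda2))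
    (lambda_le : `|lambda2| <= `|lambda1|) :
  cf_den a b p != 0 /\
  forall x1 x2 : R[i],
    lambda1 = x1 * cf_den a b p + a p * cf_den a b p.-1 ->
    lambda2 = x2 * cf_den a b p + a p * cf_den a b p.-1 ->
    let a' := rev_a p a in
    let b' := rev_b p b in
    let exceptional :=
      `|lambda2| < `|lambda1| /\
      exists q : nat, (q.+2 <= p)%N /\
        cf_num a' b' q.+1 - (b 0%N - x1) * cf_den a' b' q.+1 = 0 in
    alpha = x1 /\
    (~ exceptional -> cf_converges_to a' b' (b 0%N - x2)) /\
    (exceptional -> cf_divergent a' b').
Proof.
have p0 : (0 < p)%N by [].
have a_nz n : a n.+1 != 0.
  have -> : a n.+1 = a (n %% p).+1.
    rewrite [in LHS](divn_eq n p); elim: (n %/ p)%N => // k <-.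
    by rewrite mulSn -addnA addnC -addSn a_periodic.
  by apply: a_neq0; rewrite /= ltn_pmod.
set A := cf_num a b p; set E := a p * cf_num a b p.-1.
set B := cf_den a b p; set F := a p * cf_den a b p.-1.
have HN n : cf_num a b (n + p)%N = A * cf_num a b n + E * cf_den a b n.
  by apply: cf_num_period => // k; rewrite a_periodic.
have HD n : cf_den a b (n + p)%N = B * cf_num a b n + F * cf_den a b n.
  by apply: cf_den_period => // k; rewrite a_periodic.
move/(cf_converges_toE (R[i] : numFieldType)): alpha_cvg => acv.
have B0 : B != 0.
  (* If [B] vanished, so would the denominator at every multiple of [p], since
     [cf_den a b 0 = 0]. *)
  apply/negP => /eqP B0; have [nz _] := ratio_cvg_subseq _ p 0 _ _ _ p0 acv.
  have {}HD n : cf_den a b (n + p)%N = F * cf_den a b n.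
    by rewrite HD B0 mul0r add0r.
  have [k /eqP[]] := filter_ex nz.
  by rewrite (geometric_subseq _ _ _ _ HD) mulr0.
split; first exact: B0.
move=> x1 x2 l1E l2E a' b' exceptional.
have [trE detE] : lambda1 + lambda2 = A + F /\ lambda1 * lambda2 = A * F - E * B.
  apply: quadratic_roots => l; rewrite -eigenvalues eigenvalue_mx2 !mxE /=.
  by rewrite -/A -/B -/E -/F; split=> <-; ring.
have det0 : lambda1 * lambda2 != 0.
  have := cf_cross_neq0 _ a b a_nz p.-1; rewrite prednK // -/A -/B => H.
  rewrite detE /F /E.
  have -> : A * (a p * cf_den a b p.-1) - a p * cf_num a b p.-1 * B =
    a p * (A * cf_den a b p.-1 - cf_num a b p.-1 * B) by ring.
  by rewrite mulf_neq0 // -(prednK p0) a_nz.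
have [l1nz l2nz] : lambda1 != 0 /\ lambda2 != 0.
  by move: det0; rewrite mulf_eq0 negb_or => /andP.
have xl : (x1 == x2) = (lambda1 == lambda2).
  by rewrite l1E l2E (inj_eq (addIr _)) (inj_eq (mulIf B0)).
have H1 := eigenform_period _ _ _ _ _ _ _ _ _ _ _ HN HD B0 l1E trE detE.
have trE2 : lambda2 + lambda1 = A + F by rewrite addrC.
have detE2 : lambda2 * lambda1 = A * F - E * B by rewrite mulrC.
have H2 := eigenform_period _ _ _ _ _ _ _ _ _ _ _ HN HD B0 l2E trE2 detE2.
have [dB nB dF nF] := cf_rev_period _ p a b p0.
rewrite -/a' -/b' -/A -/B -/E -/F in dB nB dF nF.
have a'_periodic k : a' (k.+1 + p)%N = a' k.+1 by apply: rev_a_periodic.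
have b'_periodic k : b' (k + p)%N = b' k by apply: rev_b_periodic.
have HN' := cf_num_period _ p a' b' p0 a'_periodic b'_periodic.
have HD' := cf_den_period _ p a' b' p0 a'_periodic b'_periodic.
rewrite dB dF in HD'; rewrite nB nF in HN'.
have H1' n : cf_num a' b' (n + p)%N - (b 0%N - x2) * cf_den a' b' (n + p)%N =
    lambda2 * (cf_num a' b' n - (b 0%N - x2) * cf_den a' b' n).
  apply: (eigenform_period _ _ _ _ _ _ _ _ lambda1 _ _ HN' HD' B0).
  (* By the trace, [(b 0 - x2) * B + (A - b 0 * B) = A - x2 * B = lambda1]. *)
  - by rewrite -[LHS](addrK lambda2) trE l2E -/B -/F; ring.
  - by rewrite trE; ring.
  - by rewrite detE; ring.
have H2' n : cf_num a' b' (n + p)%N - (b 0%N - x1) * cf_den a' b' (n + p)%N =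
    lambda1 * (cf_num a' b' n - (b 0%N - x1) * cf_den a' b' n).
  apply: (eigenform_period _ _ _ _ _ _ _ _ lambda2 _ _ HN' HD' B0).
  - by rewrite -[LHS](addrK lambda1) trE2 l1E -/B -/F; ring.
  - by rewrite trE2; ring.
  - by rewrite detE2; ring.
have init (u v : nat -> R[i]) y : cf_num u v 0 - y * cf_den u v 0 != 0.
  by rewrite /= mulr0 subr0 oner_neq0.
have [lt|nlt] := boolP (`|lambda2| < `|lambda1|).
  have xx : x1 != x2 by rewrite xl; apply: contraTneq lt => ->; rewrite ltxx.
  have yy : b 0%N - x2 != b 0%N - x1 by rewrite (inj_eq (addrI _)) eqr_opp eq_sym.
  split.
    (* The limit exists by hypothesis, so the class of index -1 alone identifies it. *)
    have c0 := ratio_cvg_subseq _ p 0 _ _ _ p0 acv.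
    apply: ratio_cvg_unique c0 _.
    exact: (ratio_cvg_geometric _ _ _ _ _ _ _ _ _ H1 H2 lt xx (init a b x2)).
  split=> [nexc|[_ [q [qp q0]]] [l /(cf_converges_toE (R[i] : numFieldType)) lcv]].
    apply/(cf_converges_toE (R[i] : numFieldType)).
    apply: (ratio_cvg_residues (R[i] : numFieldType) _ _ _ _ p0) => q qp.
    apply: (ratio_cvg_geometric _ _ _ _ _ _ _ _ _ H1' H2' lt yy).
    (* In the shifted index, 0 stands for -1 and [q.+1] for the [q] of the exceptional condition. *)
    case: q qp => [|q] qp; first exact: (init a' b').
    by apply/eqP => q0; apply: nexc; split=> //; exists q.
  (* A limit of the reverse fraction would equal both [b 0 - x2], from index -1, and [b 0 - x1],
     from index [q]. The nonzero denominators in the latter class come from the assumed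
     convergence. *)
  have := ratio_cvg_subseq _ p q.+1 _ _ _ p0 lcv => -[nz cv].
  have := ratio_cvg_geometric _ _ _ _ _ _ _ _ _ H1' H2' lt yy (init a' b' _) => c0.
  have c1 := ratio_cvg_subseq _ p 0 _ _ _ p0 lcv.
  have e1 := ratio_cvg_unique _ _ _ _ _ c0 c1.
  have c2 : ratio_cvg (fun k => cf_num a' b' (q.+1 + k * p)%N : (R[i] : numFieldType))
      (fun k => cf_den a' b' (q.+1 + k * p)%N) (b 0%N - x1).
    apply: (@ratio_cvg_proportional (R[i] : numFieldType)) => // k.
    have := geometric_subseq _ _ _
      (fun n => cf_num a' b' n - (b 0%N - x1) * cf_den a' b' n) H2' q.+1 k.
    by rewrite q0 mulr0.
  have e2 := ratio_cvg_unique _ _ _ _ _ c2 (conj nz cv).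
  by move: yy; rewrite e1 e2 eqxx.
have nE : `|lambda2| = `|lambda1|.
  by apply/eqP; move: nlt; rewrite lt_neqAle lambda_le andbT negbK.
have lE : lambda1 = lambda2.
  have [x12|xx] := eqVneq x1 x2; first by apply/eqP; rewrite -xl x12.
  apply: esym; pose C : numFieldType := R[i].
  exact: (ratio_cvg_equimodular C _ _ _ _ _ _ _ _ p0 H1 H2 nE xx
            (erefl _) (erefl _) l1nz acv).
have xE : x1 = x2 by apply/eqP; rewrite xl lE.
split.
  apply: ratio_cvg_unique (ratio_cvg_subseq _ p 0 _ _ _ p0 acv) _.
  apply: (ratio_cvg_parabolic _ _ _ _ _ _ lambda2 B) => //.
    by move=> n; rewrite HD l2E xE; ring.
  by rewrite /= oner_neq0.
split=> [_|[]]; last by rewrite nE ltxx.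
apply/(cf_converges_toE (R[i] : numFieldType)).
apply: (ratio_cvg_residues (R[i] : numFieldType) _ _ _ _ p0) => q qp.
apply: (ratio_cvg_parabolic _ _ _ _ _ _ lambda2 B) => //.
  move=> n; rewrite HD'; have -> : A = lambda1 + lambda2 - F by rewrite trE addrK.
  by rewrite l1E xE l2E -/B -/F; ring.
have a'_nz n : a' n.+1 != 0.
  rewrite /a' /rev_a /= a_neq0 // subn_gt0 ltn_pmod //= leq_subr.
  by [].
(* A common zero of numerator and denominator would annihilate the determinant. *)
rewrite -negb_and; apply/negP => /andP[/eqP n0 /eqP d0].
by have /eqP[] := cf_cross_neq0 _ a' b' a'_nz q; rewrite n0 d0; ring.
Qed.
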